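(* (Lyons–Victoir extension theorem.) Let $\alpha\in(0,1)$, $T>0$ and $\ell\ge1$. Given any $\mathbb R^\ell$-valued $\alpha$-Hölder control $h=(h^1,\dots,h^\ell)$ on the time interval $[0,T]$, there exists an ($\alpha$-Hölder) branched rough path $\mathsf g$ above $h$, that is, a branched rough path with $\mathsf g_t(\bullet_j)=h^j(t)$ for all $t\in[0,T]$ and $1\le j\le\ell$.
   Context: Consider non-planar rooted trees with node decorations in $\{1,\dots,\ell\}$ and no edge decorations; $\bullet_j$ is the one-node tree with decoration $j$, and $\sharp\tau$ is the number of nodes of $\tau$; the homogeneity of $\tau$ is $\alpha\,\sharp\tau$. Let $T^+$ be the free commutative unital algebra generated by the trees $\tau$ with $\alpha\,\sharp\tau<1$ (the empty tree is the unit; products of trees are forests). The coproduct $\Delta^+:T^+\to T^+\otimes T^+$ is the algebra morphism given on trees by $\Delta^+\tau=\sum_{s}s\otimes(\tau/s)$, the sum over all subtrees $s$ of $\tau$ containing the root of $\tau$ (with induced decorations), together with the empty tree (for which $\tau/s=\tau$); $\tau/s$ is the product of the decorated rooted trees obtained by removing from $\tau$ the subtree $s$ and all edges adjacent to $s$ (Butcher–Connes–Kreimer Hopf algebra). $G^+$ is the group of characters of $T^+$ (nonzero algebra morphisms $T^+\to\mathbb R$) with product $g_1*g_2=(g_1\otimes g_2)\Delta^+$. An $\alpha$-Hölder branched rough path on $[0,T]$ is a map $\mathsf g:[0,T]\to G^+$ such that, with $\mathsf g_{ts}:=(\mathsf g_t\otimes\mathsf g_s^{-1})\Delta^+$, for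 each tree $\tau$ with $\alpha\,\sharp\tau<1$ the function $t\mapsto\mathsf g_t(\tau)$ is bounded and $\sup_{s\neq t\in[0,T]}|\mathsf g_{ts}(\tau)|/|t-s|^{\alpha\,\sharp\tau}<\infty$. *)

(* Defs.v *)
From HB Require Import structures.
From mathcomp Require Import all_boot all_order all_algebra.
From mathcomp Require Import finmap.
From mathcomp.multinomials Require Import monalg.
From mathcomp Require Import boolp classical_sets reals topology normedtype exp.

Set Implicit Arguments.
Unset Strict Implicit.
Unset Printing Implicit Defensive.

Import Order.TTheory GRing.Theory Num.Theory numFieldNormedType.Exports.

Local Open Scope ring_scope.

(* Planar trees [ptree l] only serve to represent the non-planar trees [tree l];
   decorations range over 'I_l, i.e. {0, ..., l-1} in place of {1, ..., l}. *)

Section PlanarTrees.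
Variable l : nat.

Inductive ptree : Type := PNode of 'I_l & seq ptree.

Lemma ptree_ind' (P : ptree -> Prop) :
  (forall j ts, foldr (fun t Q => P t /\ Q) True ts -> P (PNode j ts)) ->
  forall t, P t.
Proof.
move=> HP; fix IH 1 => -[j ts]; apply: HP.
by elim: ts => //= t ts IHts; split.
Qed.

Fixpoint ptree_encode (t : ptree) : GenTree.tree void :=
  let: PNode j ts := t in GenTree.Node j (map ptree_encode ts).

Fixpoint ptree_decode (t : GenTree.tree void) : option ptree :=
  if t is GenTree.Node n ts then
    omap (fun j => PNode j (pmap ptree_decode ts)) (insub n)
  else None.

Lemma ptree_encodeK : pcancel ptree_encode ptree_decode.
Proof.
elim/ptree_ind' => j ts IH /=; rewrite valK /=; congr (Some (PNode _ _)).
by elim: ts IH => //= t ts IHts [-> /IHts] /= ->.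
Qed.

HB.instance Definition _ := Countable.copy ptree (pcan_type ptree_encodeK).

Fixpoint psize (t : ptree) : nat :=
  let: PNode _ ts := t in (sumn (map psize ts)).+1.

(* All pairs (s, [:: u1; ...; uk]), where s is a subtree of t containing the
   root and u1, ..., uk are the trees left when s and the edges adjacent to s
   are removed.  For each child u of the root, either u is cut off entirely, or
   a subtree of u containing the root of u is kept.  Distinct node sets give
   distinct entries of the list, even when the resulting pairs coincide; the
   empty subtree is not listed. *)
Fixpoint root_subtrees (t : ptree) : seq (ptree * seq ptree) :=
  let: PNode j ts := t in
  [seq (PNode j c.1, c.2) | c <-
     foldr (fun u cs =>
       [seq (b.1 ++ c.1, b.2 ++ c.2) |
          b <- ([::], [:: u]) :: [seq ([:: d.1], d.2) | d <- root_subtrees u],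
          c <- cs])
     [:: ([::], [::])] ts].

Definition pleq (t u : ptree) : bool := (choice.pickle t <= choice.pickle u)%N.

(* Representative of t modulo reordering of the children of every node; the
   order [pleq] is an arbitrary total order. *)
Fixpoint canon (t : ptree) : ptree :=
  let: PNode j ts := t in PNode j (sort pleq (map canon ts)).

Lemma pleq_total : total pleq. Proof. by move=> t u; apply: leq_total. Qed.
Lemma pleq_trans : transitive pleq. Proof. by move=> t u v; apply: leq_trans. Qed.
Lemma pleq_anti : antisymmetric pleq.
Proof. by move=> t u /anti_leq/(pcan_inj (@choice.pickleK _)). Qed.

Lemma canonK t : canon (canon t) = canon t.
Proof.
elim/ptree_ind': t => j ts IH /=; congr PNode.
rewrite -[RHS](sorted_sort pleq_trans (sort_sorted pleq_total _)).
congr sort; rewrite -[RHS]map_id.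
apply/eq_in_map => u; rewrite mem_sort => /mapP[v + ->].
by elim: ts IH => //= t ts IHts [tK /IHts {}IHts]; rewrite in_cons => /predU1P[-> //|/IHts].
Qed.

Lemma canon_eqP j ts k us :
  reflect (j = k /\ perm_eq (map canon ts) (map canon us))
          (canon (PNode j ts) == canon (PNode k us)).
Proof.
apply: (iffP eqP) => /= [[-> /(perm_sortP pleq_total pleq_trans pleq_anti)]|[-> ?]] //.
by congr PNode; apply/(perm_sortP pleq_total pleq_trans pleq_anti).
Qed.

Lemma psize_canon t : psize (canon t) = psize t.
Proof.
elim/ptree_ind': t => j ts IH /=; congr _.+1.
rewrite !sumnE (perm_big (map psize (map canon ts))); last first.
  by apply: perm_map; rewrite perm_sort.
by rewrite -!sumnE; congr sumn; elim: ts IH => //= t ts IHts [-> /IHts] ->.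
Qed.

(* [ropts u]: the choices at a child u of the root; [rforest ts]: the choices
   at all the children ts of the root. *)
Definition ropts (u : ptree) : seq (seq ptree * seq ptree) :=
  ([::], [:: u]) :: [seq ([:: d.1], d.2) | d <- root_subtrees u].

Fixpoint rforest (ts : seq ptree) : seq (seq ptree * seq ptree) :=
  if ts is u :: us then
    [seq (b.1 ++ c.1, b.2 ++ c.2) | b <- ropts u, c <- rforest us]
  else [:: ([::], [::])].

Lemma rforest_cons u us : rforest (u :: us) =
  [seq (b.1 ++ c.1, b.2 ++ c.2) | b <- ropts u, c <- rforest us].
Proof. by []. Qed.

Lemma root_subtreesE j ts :
  root_subtrees (PNode j ts) = [seq (PNode j c.1, c.2) | c <- rforest ts].
Proof. by rewrite /=; congr map; elim: ts => //= t ts ->. Qed.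

Lemma psize_root_subtrees t c : c \in root_subtrees t ->
  (psize c.1 + sumn (map psize c.2) = psize t)%N.
Proof.
elim/ptree_ind': t c => j ts IH c; rewrite root_subtreesE => /mapP[d + ->] /=.
rewrite addSn; move=> dts; congr _.+1.
elim: ts IH d dts => [_ d|t ts IHts [IHt /IHts{}IHts] d].
  by rewrite inE => /eqP ->.
rewrite rforest_cons; case/allpairsPdep=> b [e [bt /IHts /= <- ->]] /=.
rewrite !map_cat !sumn_cat addnACA; congr (_ + _)%N.
by move: bt; rewrite inE => /predU1P[->|/mapP[x /IHt <- ->]]/=; rewrite ?addn0.
Qed.

Section Sums.
Variable A : comNzRingType.
Implicit Types (Phi : seq ptree -> A) (B C : ptree -> A).

Definition fprod (C : ptree -> A) (f : seq ptree) : A := \prod_(u <- f) C u.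

Lemma fprod_cat C f g : fprod C (f ++ g) = fprod C f * fprod C g.
Proof. exact: big_cat. Qed.

Definition fsum Phi C ts := \sum_(c <- rforest ts) Phi c.1 * fprod C c.2.
Definition osum Phi C t := \sum_(c <- ropts t) Phi c.1 * fprod C c.2.
(* phi (x) C applied to the coproduct of t, without the term 1 (x) t of the
   empty subtree; [tconv] below includes that term. *)
Definition tsum (phi : ptree -> A) C t :=
  \sum_(c <- root_subtrees t) phi c.1 * fprod C c.2.

Lemma tsumE phi C j ts :
  tsum phi C (PNode j ts) = fsum (fun s => phi (PNode j s)) C ts.
Proof. by rewrite /tsum root_subtreesE big_map. Qed.

Lemma osumE Phi C t :
  osum Phi C t = Phi [::] * C t + tsum (fun s => Phi [:: s]) C t.
Proof. by rewrite /osum big_cons /= big_map /fprod big_seq1. Qed.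

Lemma fsum_nil Phi C : fsum Phi C [::] = Phi [::].
Proof. by rewrite /fsum big_seq1 /= /fprod big_nil mulr1. Qed.

Lemma fsum_cons Phi C t ts :
  fsum Phi C (t :: ts) = osum (fun u => fsum (fun v => Phi (u ++ v)) C ts) C t.
Proof.
rewrite /fsum rforest_cons big_allpairs_dep /=; apply: eq_bigr => b _.
rewrite mulr_suml; apply: eq_bigr => c _ /=.
by rewrite fprod_cat mulrA mulrAC.
Qed.

Lemma eq_osum Phi Phi' C t : Phi =1 Phi' -> osum Phi C t = osum Phi' C t.
Proof. by move=> e; apply: eq_bigr => c _; rewrite e. Qed.
Lemma eq_fsum Phi Phi' C t : Phi =1 Phi' -> fsum Phi C t = fsum Phi' C t.
Proof. by move=> e; apply: eq_bigr => c _; rewrite e. Qed.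

Lemma fsum_seq1 Phi C t : fsum Phi C [:: t] = osum Phi C t.
Proof. by rewrite fsum_cons; apply: eq_osum => u; rewrite fsum_nil cats0. Qed.

Lemma fsum_cat Phi C ts us :
  fsum Phi C (ts ++ us) = fsum (fun u => fsum (fun v => Phi (u ++ v)) C us) C ts.
Proof.
elim: ts Phi => [|t ts IH] Phi; first by rewrite fsum_nil.
rewrite /= !fsum_cons; apply: eq_osum => u; rewrite IH.
by apply: eq_fsum => v; apply: eq_fsum => w; rewrite catA.
Qed.

Lemma exchange_fsum (Phi : seq ptree -> seq ptree -> A) B C ts us :
  fsum (fun u => fsum (Phi u) C us) B ts
  = fsum (fun v => fsum (Phi^~ v) B ts) C us.
Proof.
rewrite /fsum; under eq_bigr do rewrite mulr_suml.
rewrite exchange_big; apply: eq_bigr => c _ /=; rewrite mulr_suml.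
by apply: eq_bigr => b _; rewrite mulrAC.
Qed.

Definition tconv B C t := C t + tsum B C t.

Lemma fsum_coassoc_nil (ts : seq ptree) :
  foldr (fun t Q => (forall phi B C,
    tsum (tsum phi B) C t = tsum phi (tconv B C) t) /\ Q) True ts ->
  forall Phi B C, fsum (fsum Phi B) C ts = fsum Phi (tconv B C) ts.
Proof.
elim: ts => [|t ts IHts] /= H Phi B C; first by rewrite !fsum_nil.
case: H => IHt /IHts{}IHts; rewrite !fsum_cons.
transitivity (osum (fsum (fun u => fsum (fun v => Phi (u ++ v)) (tconv B C) ts) B) C t).
  apply: eq_osum => u.
  under eq_fsum do rewrite fsum_cat.
  by rewrite exchange_fsum; apply: eq_fsum => v; apply: IHts.
move: (fun u => _) => Psi; rewrite !osumE fsum_nil -IHt /tconv mulrDr -addrA.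
congr (_ + _); rewrite /tsum mulr_sumr -big_split /=; apply: eq_bigr => c _.
by rewrite fsum_seq1 osumE mulrDl mulrA.
Qed.

Lemma tsum_coassoc phi B C t : tsum (tsum phi B) C t = tsum phi (tconv B C) t.
Proof.
elim/ptree_ind': t phi B C => j ts IH phi B C; rewrite !tsumE.
rewrite -(fsum_coassoc_nil IH); apply: eq_fsum => s; exact: tsumE.
Qed.

Definition finv Phi :=
  forall s s', perm_eq (map canon s) (map canon s') -> Phi s = Phi s'.
Definition tinv (phi : ptree -> A) := forall t, phi (canon t) = phi t.

Lemma finv_cat Phi u : finv Phi -> finv (fun v => Phi (u ++ v)).
Proof. by move=> H v v' e; apply: H; rewrite !map_cat perm_cat2l. Qed.

Lemma fsum_perm Phi C ts us : finv Phi -> perm_eq ts us ->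
  fsum Phi C ts = fsum Phi C us.
Proof.
move=> HPhi; move: ts us.
apply: catCA_perm_subst => t1 t2 t3; rewrite !fsum_cat.
under eq_fsum do rewrite fsum_cat; under [RHS]eq_fsum do rewrite fsum_cat.
rewrite exchange_fsum; apply: eq_fsum => u; apply: eq_fsum => v.
apply: eq_fsum => w; apply: HPhi; rewrite !map_cat.
by apply/permP => a; rewrite !count_cat addnCA.
Qed.

Lemma tsum_canon phi C t : tinv phi -> tinv C ->
  tsum phi C (canon t) = tsum phi C t.
Proof.
elim/ptree_ind': t phi => j ts IH phi Hphi HC; rewrite [canon _]/= !tsumE.
have Hf : finv (fun s => phi (PNode j s)).
  by move=> s s' e; rewrite -Hphi -[RHS]Hphi; congr phi; apply/eqP/canon_eqP.
rewrite (@fsum_perm _ _ _ (map canon ts) Hf); last by rewrite perm_sort.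
move: (fun s => _) Hf => Phi HPhi {phi Hphi}.
elim: ts IH Phi HPhi => [|t ts IHts] //= [IHt /IHts{}IHts] Phi HPhi.
rewrite !fsum_cons !osumE HC IHt //; last first.
  move=> x; apply: eq_fsum => v; apply: HPhi => /=.
  by rewrite canonK.
rewrite IHts; last exact: finv_cat.
by congr (_ + _); apply: eq_bigr => c _; rewrite IHts //; exact: finv_cat.
Qed.

End Sums.
End PlanarTrees.

(* Non-planar rooted trees; equality is described by [tree_of_nodeP]. *)
Definition tree (l : nat) : Type := {t : ptree l | canon t == t}.
HB.instance Definition _ l := Choice.copy (tree l) {t : ptree l | canon t == t}.

Definition tree_of l (t : ptree l) : tree l :=
  exist _ (canon t) (introT eqP (canonK t)).

Lemma tree_ofK l (x : tree l) : tree_of (val x) = x.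
Proof. by apply: val_inj; apply/eqP/(valP x). Qed.

Lemma tree_of_nodeP l j k (ts us : seq (ptree l)) :
  reflect (j = k /\ perm_eq (map (@tree_of l) ts) (map (@tree_of l) us))
          (tree_of (PNode j ts) == tree_of (PNode k us)).
Proof.
rewrite -val_eqE /=.
have vE (vs : seq (ptree l)) : map (@canon l) vs = map val (map (@tree_of l) vs).
  by rewrite -map_comp.
apply: (iffP (canon_eqP _ _ _ _)) => -[-> H]; split=> //; move: H; rewrite !vE.
  exact: perm_map_inj val_inj _ _.
exact: perm_map.
Qed.

Definition bullet l (j : 'I_l) : tree l := tree_of (PNode j [::]).

Definition tree_size l (x : tree l) : nat := psize (val x).

(* M * N as a product monoid: the monoid algebra R[M * N] is the tensor product
   of R[M] and R[N], the basis element << (m, n) >> standing for m (x) n. *)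
Section ProductMonomial.
Variables M N : conomType.
Definition pmone : M * N := (mone, mone).
Definition pmmul (x y : M * N) : M * N := (mmul x.1 y.1, mmul x.2 y.2).
Lemma pmmulA : associative pmmul.
Proof. by move=> x y z; rewrite /pmmul /= !mulmA. Qed.
Lemma pmmul1m : left_id pmone pmmul.
Proof. by case=> x y; rewrite /pmmul /= !mul1m. Qed.
Lemma pmmulm1 : right_id pmone pmmul.
Proof. by case=> x y; rewrite /pmmul /= !mulm1. Qed.
Lemma pmunitm x y : pmmul x y = pmone -> x = pmone /\ y = pmone.
Proof. by case: x y => [a b] [c d] [/unitm[-> ->] /unitm[-> ->]]. Qed.
Lemma pmmulC : commutative pmmul.
Proof. by move=> x y; rewrite /pmmul mulmC [mmul x.2 _]mulmC. Qed.
HB.instance Definition _ := Choice_isMonomialDef.Build (M * N)%type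
  pmmulA pmmul1m pmmulm1 pmunitm.
HB.instance Definition _ := MonomialDef_isConomialDef.Build (M * N)%type pmmulC.
End ProductMonomial.

(* Multiplicative extension of f from I to the free commutative monoid on I. *)
Section Lift.
Variables (I : choiceType) (A : comNzRingType) (f : I -> A).
Definition mlift (m : {cmonom I}) : A := \prod_(i <- finsupp m) f i ^+ m i.

Lemma mliftE (d : {fset I}) (m : {cmonom I}) : fsubset (finsupp m) d ->
  mlift m = \prod_(i <- d) f i ^+ m i.
Proof.
move=> md; rewrite /mlift; apply: big_fset_incl => // i _.
by rewrite -cmE_eq0 => /eqP ->; rewrite expr0.
Qed.

Lemma mlift_mmorphism : mmorphism mlift.
Proof.
split=> [m n|]; last by rewrite /mlift mdom1 big_seq_fset0.
rewrite (@mliftE (fsetU (finsupp m) (finsupp n)) (mmul m n)); last by rewrite mdomD.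
rewrite (@mliftE (fsetU (finsupp m) (finsupp n)) m); last by rewrite fsubsetUl.
rewrite (@mliftE (fsetU (finsupp m) (finsupp n)) n); last by rewrite fsubsetUr.
by rewrite -big_split /=; apply: eq_bigr => i _; rewrite cmM exprD.
Qed.
HB.instance Definition _ := isMultiplicative.Build _ _ mlift mlift_mmorphism.

Lemma mliftU i : mlift (ucm i) = f i.
Proof. by rewrite /mlift mdomU big_seq_fset1 cmUU. Qed.
End Lift.

Lemma cmonom_ind (I : choiceType) (P : {cmonom I} -> Prop) :
  P mone -> (forall i m, P m -> P (mmul (ucm i) m)) -> forall m, P m.
Proof.
move=> P1 PM m; have [n] := ubnP (mdeg m); elim: n m => // n IHn m.
have [->//|m1] := eqVneq m mone.
have [i mi] : exists i, m i != 0%N.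
  apply: contrapT => m0; case/eqP: m1; apply/eqP/cmP => i.
  by rewrite cm1; apply: contrapT => mi; apply: m0; exists i; apply/eqP.
have -> : m = mmul (ucm i) (divcm m (ucm i)).
  apply/eqP/cmP => k; rewrite cmM divcmE cmU.
  by case: eqVneq => [<-|_]; rewrite ?subnKC ?subn0 // lt0n.
by rewrite mdegM mdegU add1n ltnS => /IHn; apply: PM.
Qed.

Section LinearExtension.
Variables (R : comNzRingType) (K L : conomType) (h : {mmorphism K -> {malg R[L]}}).

(* Linear extension of h to the monoid algebra; it is an algebra morphism. *)
Definition mextend : {malg R[K]} -> {malg R[L]} := mmap malgC h.

Lemma mextend_is_linear : linear mextend.
Proof. by move=> c x y; rewrite /mextend raddfD /= mmapZ /= mul_malgC. Qed.

Lemma mextend_is_monoid_morphism : monoid_morphism mextend.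
Proof. by split; [apply: rmorph1 | apply: rmorphM]. Qed.

HB.instance Definition _ := GRing.isLinear.Build R {malg R[K]} {malg R[L]}
  *:%R mextend mextend_is_linear.
HB.instance Definition _ := GRing.isMonoidMorphism.Build {malg R[K]} {malg R[L]}
  mextend mextend_is_monoid_morphism.

Lemma mextendU m : mextend << m >> = h m.
Proof. by rewrite [LHS]mmapU [LHS]mul1r. Qed.

End LinearExtension.

Section BCK.
Variables (R : realType) (l : nat) (alpha : R).

Definition small : pred (tree l) := fun x => alpha * (tree_size x)%:R < 1.
Definition small_tree : Type := {x : tree l | small x}.
HB.instance Definition _ := Choice.copy small_tree {x : tree l | small x}.

(* T^+ is the free commutative algebra on the small trees: the monoid algebra of
   the forests of small trees. *)
Local Notation Tplus := {malg R[{cmonom small_tree}]}.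
Local Notation Tplus2 := {malg R[({cmonom small_tree} * {cmonom small_tree})%type]}.

Definition tree_elt (x : small_tree) : Tplus := << ucm x >>.

(* The forest with the given trees, as a basis element of T^+.  A tree that is
   not small would be dropped; this never happens below, because the trees
   obtained by cutting a small tree are small (see [small_sub]). *)
Definition forest (f : seq (ptree l)) : {cmonom small_tree} :=
  \big[mmul/mone]_(x <- pmap insub (map (@tree_of l) f)) ucm x.

(* The first summand, 1 (x) tau, is the term of the empty subtree. *)
Definition coproduct_tree (x : small_tree) : Tplus2 :=
  << (mone, ucm x) >> +
  \sum_(c <- root_subtrees (val (val x))) << (forest [:: c.1], forest c.2) >>.

Definition coproduct : {lrmorphism Tplus -> Tplus2} :=
  mextend (mlift coproduct_tree).

(* Elements of G^+.  A nonzero algebra morphism to R maps 1 to 1, so these are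
   the unital ones, i.e. the algebra morphisms of the library. *)
Definition character := {lrmorphism Tplus -> R | *%R}.

Implicit Types a b : character.

(* [tensor a b] is a (x) b : T^+ (x) T^+ -> R. *)
Definition tensor_mon a b (m : {cmonom small_tree} * {cmonom small_tree}) : R :=
  a << m.1 >> * b << m.2 >>.

Lemma charM a (m n : {cmonom small_tree}) :
  a << mmul m n >> = a << m >> * a << n >>.
Proof. by rewrite -rmorphM; congr (a _); rewrite [RHS]fgmulUU mulr1. Qed.

Lemma tensor_mmorphism a b : mmorphism (tensor_mon a b).
Proof.
split=> [m n|].
  exact: etrans (congr2 *%R (charM a m.1 n.1) (charM b m.2 n.2)) (mulrACA _ _ _ _).
exact: etrans (congr2 *%R (rmorph1 a) (rmorph1 b)) (mulr1 _).
Qed.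

HB.instance Definition _ a b := isMultiplicative.Build _ _ (tensor_mon a b)
  (tensor_mmorphism a b).

Definition tensor a b : {lrmorphism Tplus2 -> R | *%R} :=
  mmap idfun (tensor_mon a b).

Definition char_mul a b : character := tensor a b \o coproduct.

Definition char_of (v : small_tree -> R) : character := mmap idfun (mlift v).

Lemma char_ofE v x : char_of v (tree_elt x) = v x.
Proof. by rewrite [LHS]mmapU; exact: etrans (mul1r _) (mliftU v x). Qed.

Lemma eq_char a b : (forall x, a (tree_elt x) = b (tree_elt x)) -> a = b.
Proof.
move=> ab; have mon m : a << m >> = b << m >>.
  elim/cmonom_ind: m => [|i m IH]; first exact: etrans (rmorph1 a) (esym (rmorph1 b)).
  exact: etrans (charM a _ _) (etrans (congr2 *%R (ab i) IH) (esym (charM b _ _))).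
have {}ab : a =1 b.
  move=> p; rewrite (monalgE p) !raddf_sum; apply: eq_bigr => m _ /=.
  have -> : << p@_m *g m >> = p@_m *: << m >> :> Tplus.
    by rewrite -mul_malgC [RHS]fgmulUU mulr1 mul1m.
  exact: etrans (linearZ_LR a _ _) (etrans (congr1 _ (mon m)) (esym (linearZ_LR b _ _))).
move: a b ab {mon} => [f [[fa] [fm] [fs]]] [g [[ga] [gm] [gs]]] /= /funext fg.
move: ga gm gs; rewrite -fg => ga gm gs.
by congr (GRing.LRMorphism.Pack (GRing.LRMorphism.Class _ _ _)); congr (_ _); apply: Prop_irrelevance.
Qed.

(* Value of a at the class of the planar tree t (see [aev_small]). *)
Definition aev a (t : ptree l) : R := a << forest [:: t] >>.

Lemma aev_inv a : tinv (aev a).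
Proof.
move=> t; have e : map (@tree_of l) [:: canon t] = map (@tree_of l) [:: t].
  by congr [:: _]; apply: val_inj; apply: canonK.
by rewrite /aev /forest e.
Qed.

Lemma forest_nil : forest [::] = mone. Proof. exact: big_nil. Qed.

Lemma forest_cons t f : forest (t :: f) = mmul (forest [:: t]) (forest f).
Proof. by rewrite /forest -cat1s map_cat pmap_cat big_cat. Qed.

Lemma char_forest a f : a << forest f >> = fprod (aev a) f.
Proof.
elim: f => [|t f IH].
  by rewrite forest_nil /fprod big_nil; exact: rmorph1.
rewrite forest_cons [RHS]/fprod big_cons.
exact: etrans (charM a _ _) (congr1 _ IH).
Qed.

Lemma aev_small a x : aev a (val (val x)) = a (tree_elt x).
Proof.
by rewrite /aev /forest /= tree_ofK valK /= big_seq1.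
Qed.

Lemma char_mulE a b x :
  char_mul a b (tree_elt x) = tconv (aev a) (aev b) (val (val x)).
Proof.
transitivity (tensor a b (coproduct_tree x)).
  apply: (congr1 (tensor a b)); exact: etrans (mextendU _ _) (mliftU _ _).
have tE m n : tensor a b << (m, n) >> = a << m >> * b << n >>.
  by rewrite [LHS]mmapU; exact: mul1r.
rewrite /coproduct_tree raddfD raddf_sum /= /tconv aev_small; congr (_ + _).
  by rewrite tE; exact: etrans (congr1 ( *%R^~ _) (rmorph1 a)) (mul1r _).
apply: eq_bigr => c _; rewrite tE.
exact: congr2 (erefl _) (char_forest b c.2).
Qed.

Lemma small_le x y : (tree_size x <= tree_size y)%N -> small y -> small x.
Proof.
rewrite /small => xy; have [a0|a0] := leP 0 alpha.
  by apply: le_lt_trans; rewrite ler_wpM2l// ler_nat.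
move=> _; apply: le_lt_trans ltr01.
by rewrite mulr_le0_ge0 // ?ler0n // ltW.
Qed.

Lemma small_bullet (alpha_lt1 : alpha < 1) (j : 'I_l) : small (bullet j).
Proof. by rewrite /small /tree_size /= mulr1. Qed.

Lemma psize_gt0 (t : ptree l) : (0 < psize t)%N. Proof. by case: t. Qed.

Lemma tree_size_of (t : ptree l) : tree_size (tree_of t) = psize t.
Proof. exact: psize_canon. Qed.

Lemma small_sub (t : ptree l) c : small (tree_of t) -> c \in root_subtrees t ->
  small (tree_of c.1) /\ (forall u, u \in c.2 -> small (tree_of u) /\ (psize u < psize t)%N).
Proof.
move=> st ct; have e := psize_root_subtrees ct; split=> [|u uc].
  by apply: small_le st; rewrite !tree_size_of -e leq_addr.
have ut : (psize u < psize t)%N.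
  rewrite -e -add1n leq_add ?psize_gt0 // sumnE big_map (big_rem u) //=.
  exact: leq_addr.
by split=> //; apply: small_le st; rewrite !tree_size_of ltnW.
Qed.

Lemma eq_tsum (phi phi' C C' : ptree l -> R) t : small (tree_of t) ->
  (forall u, small (tree_of u) -> phi u = phi' u) ->
  (forall u, small (tree_of u) -> (psize u < psize t)%N -> C u = C' u) ->
  tsum phi C t = tsum phi' C' t.
Proof.
move=> st e e'; apply: eq_big_seq => c /(small_sub st)[s1 s2].
by rewrite e // /fprod (eq_big_seq C') // => u /s2[*]; apply: e'.
Qed.

Lemma aevP a t (st : small (tree_of t)) :
  aev a t = a (tree_elt (exist _ (tree_of t) st)).
Proof. by rewrite -aev_small /= aev_inv. Qed.

Lemma aev_mul a b t : small (tree_of t) ->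
  aev (char_mul a b) t = tconv (aev a) (aev b) t.
Proof.
move=> st; rewrite (aevP _ st) char_mulE.
apply: (congr2 +%R (aev_inv b t)); apply: tsum_canon; exact: aev_inv.
Qed.

Lemma aev_char_of v t (st : small (tree_of t)) :
  aev (char_of v) t = v (exist _ (tree_of t) st).
Proof. by rewrite aevP char_ofE. Qed.

Lemma small_tree_small (x : small_tree) : small (tree_of (val (val x))).
Proof. by rewrite tree_ofK; apply: valP x. Qed.

Lemma char_mulA : associative char_mul.
Proof.
move=> a b c; apply: eq_char => x; rewrite !char_mulE.
have sx := small_tree_small x; set t := val _ in sx *.
have -> : tconv (aev a) (aev (char_mul b c)) t =
    tconv (aev b) (aev c) t + tsum (aev a) (tconv (aev b) (aev c)) t.
  congr (_ + _); first exact: aev_mul.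
  by apply: (eq_tsum sx) => // u su _; apply: aev_mul.
have -> : tconv (aev (char_mul a b)) (aev c) t =
    aev c t + tsum (tconv (aev a) (aev b)) (aev c) t.
  by congr (_ + _); apply: (eq_tsum sx) => // u su; apply: aev_mul.
rewrite -tsum_coassoc /tconv -addrA; congr (_ + _).
by rewrite /tsum -big_split /=; apply: eq_bigr => d _; rewrite mulrDl.
Qed.

Definition counit : character := char_of (fun=> 0).

Lemma char_mul1g : left_id counit char_mul.
Proof.
move=> a; apply: eq_char => x; rewrite char_mulE -aev_small /tconv.
rewrite (@eq_tsum _ (fun=> 0) _ (aev a) _ (small_tree_small x)) //.
  by rewrite /tsum big1 ?addr0 // => c _; rewrite mul0r.
by move=> u su; rewrite aev_char_of.
Qed.

Lemma tsum0 (phi : ptree l -> R) t : tsum phi (fun=> 0) t = phi t.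
Proof.
elim/ptree_ind': t phi => j ts IH phi; rewrite tsumE.
suff H (Phi : seq (ptree l) -> R) : fsum Phi (fun=> 0) ts = Phi ts by exact: H.
elim: ts IH Phi => [|t ts IHts] /= H Phi; first by rewrite fsum_nil.
by case: H => IHt /IHts{}IHts; rewrite fsum_cons osumE mulr0 add0r IHt IHts.
Qed.

Lemma char_mulg1 : right_id counit char_mul.
Proof.
move=> a; apply: eq_char => x; rewrite char_mulE -aev_small /tconv.
rewrite (aev_char_of _ (small_tree_small x)) add0r.
rewrite (@eq_tsum _ (aev a) _ (fun=> 0) _ (small_tree_small x)) ?tsum0 //.
by move=> u su _; rewrite aev_char_of.
Qed.

(* Solves A * inv = counit by recursion on the size of trees; n is a bound on the
   size of t. *)
Fixpoint inv_rec n (A : ptree l -> R) t :=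
  if n is m.+1 then - tsum A (inv_rec m A) t else 0.

Lemma inv_rec_stable n m A t : (psize t <= n)%N -> (psize t <= m)%N ->
  inv_rec n A t = inv_rec m A t.
Proof.
elim: n m t => [|n IH] [|m] t //; try by rewrite leqn0 => /eqP t0; have := psize_gt0 t; rewrite t0.
  by move=> _; rewrite leqn0 => /eqP t0; have := psize_gt0 t; rewrite t0.
move=> tn tm /=; congr (- _); apply: eq_big_seq => c ct; congr (_ * _).
apply: eq_big_seq => u uc.
have ut : (psize u < psize t)%N.
  rewrite -(psize_root_subtrees ct) -add1n leq_add ?psize_gt0 //.
  by rewrite sumnE big_map (big_rem u) //= leq_addr.
by apply: IH; rewrite -ltnS; apply: leq_trans ut _.
Qed.

Lemma inv_rec_inv n A : tinv A -> tinv (inv_rec n A).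
Proof.
by move=> HA; elim: n => //= n IH t /=; rewrite tsum_canon.
Qed.

Definition char_inv a : character :=
  char_of (fun x => inv_rec (tree_size (val x)) (aev a) (val (val x))).

Lemma aev_inverse a t : small (tree_of t) ->
  aev (char_inv a) t = inv_rec (psize t) (aev a) t.
Proof.
move=> st; rewrite (aev_char_of _ st) -[psize t]tree_size_of.
exact: (inv_rec_inv _ (aev_inv a)).
Qed.

Lemma char_mulV : right_inverse counit char_inv char_mul.
Proof.
move=> a; apply: eq_char => x; rewrite char_mulE char_ofE /tconv.
have sx := small_tree_small x; set t := val _ in sx *.
rewrite aev_inverse // -(prednK (psize_gt0 t)) [inv_rec _ _ _]/=.
apply/eqP; rewrite addrC subr_eq0; apply/eqP; apply: (eq_tsum sx) => // u su ut.
rewrite aev_inverse //; apply: inv_rec_stable => //.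
by rewrite -ltnS (prednK (psize_gt0 t)).
Qed.

Lemma char_mulVl : left_inverse counit char_inv char_mul.
Proof.
move=> a; rewrite -[RHS](char_mulV (char_inv a)); congr char_mul.
by rewrite -[LHS]char_mulg1 -(char_mulV (char_inv a)) char_mulA char_mulV char_mul1g.
Qed.

HB.instance Definition _ := gen_eqMixin character.
HB.instance Definition _ := gen_choiceMixin character.
HB.instance Definition _ := isGroup.Build character
  char_mulA char_mul1g char_mulg1 char_mulVl char_mulV.

End BCK.

Arguments tree_elt {R l alpha} x.

Section RoughPaths.
Variables (R : realType) (l : nat) (alpha T : R).

Definition bullet_elt (alpha_lt1 : alpha < 1) (j : 'I_l) : small_tree l alpha :=
  exist _ (bullet j) (small_bullet alpha_lt1 j).

(* The norm on 'rV[R]_l is the maximum norm; the choice of norm does not affect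
   the notion. *)
Definition holder_control (h : R -> 'rV[R]_l) : Prop :=
  exists C : R, forall s t : R, s \in `[0, T] -> t \in `[0, T] -> s != t ->
    `|h t - h s| / `|t - s| `^ alpha <= C.

(* [g] is only constrained on [0, T]; (g t * (g s)^-1)%g is g_{ts}, the product
   and the inverse being those of the group of characters. *)
Definition branched_rough_path (g : R -> character l alpha) : Prop :=
  forall x : small_tree l alpha,
    (exists C : R, forall t : R, t \in `[0, T] -> `|g t (tree_elt x)| <= C) /\
    (exists C : R, forall s t : R, s \in `[0, T] -> t \in `[0, T] -> s != t ->
       `|(g t * (g s)^-1)%g (tree_elt x)|
         / `|t - s| `^ (alpha * (tree_size (val x))%:R) <= C).

End RoughPaths.

(* Main.v *)
(* Write g_{ts} = g_t * g_s^-1.  The path is built by induction on the number n of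
   nodes on which the Hölder bounds hold.  Given a path g that is controlled on
   trees with at most n nodes and a tree tau with n + 1 nodes, Chen's relation
   g_{ts} = g_{tu} * g_{us} shows that A(s, t) = g_{ts}(tau) is additive up to
   products of increments on strictly smaller trees, that is, up to an error of
   order |t - s|^gamma with gamma = alpha (n + 1) < 1.  Below exponent 1, every
   such A is within order |t - s|^gamma of the increment of some function f: on
   dyadic points f is defined by splitting the error A - df evenly between the two
   halves of each interval, so that its size at level k is multiplied by at most
   1/2 at each subdivision up to a term of order 2^(- k gamma), and
   2^(-gamma) > 1/2.  Finally g_t is replaced by c_t * g_t, where the character c_t
   is -f_t on tau and vanishes on trees with at most n nodes; such characters are
   central and additive up to n + 1 nodes, so this subtracts df from A. *)

Require Import Defs.
From HB Require Import structures.
From mathcomp Require Import all_boot all_order all_algebra.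
From mathcomp Require Import ring lra zify.
From mathcomp Require Import boolp classical_sets reals topology normedtype exp.

Set Implicit Arguments.
Unset Strict Implicit.
Unset Printing Implicit Defensive.

Import Order.TTheory GRing.Theory Num.Theory numFieldNormedType.Exports.

Local Open Scope ring_scope.

(** * Primitives of almost additive functions on a dyadic grid *)

(** The second hypothesis makes the intervals [u k - d k, u k + d k] decreasing, and the supremum of
    their left endpoints lies in all of them. *)
Lemma nested_limit (R : realType) (u d : nat -> R) :
  (forall k, 0 <= d k) -> (forall k, `|u k.+1 - u k| <= d k - d k.+1) ->
  exists x, forall k, `|x - u k| <= d k.
Proof.
move=> d0 ud.
have lo j k : u j - d j <= u (j + k)%N - d (j + k)%N.
  elim: k => [|k IH]; rewrite ?addn0 // addnS (le_trans IH) //.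
  have := ud (j + k)%N; rewrite ler_norml => /andP[]; lra.
have hi j k : u (j + k)%N + d (j + k)%N <= u j + d j.
  elim: k => [|k IH]; rewrite ?addn0 // addnS (le_trans _ IH) //.
  have := ud (j + k)%N; rewrite ler_norml => /andP[]; lra.
have lohi j k : u j - d j <= u k + d k.
  have := lo j k; have := hi k j; have := d0 (j + k)%N; rewrite [(k + j)%N]addnC; lra.
pose E := [set u k - d k | k in [set: nat]]%classic.
exists (sup E) => k; rewrite ler_distl; apply/andP; split.
  by apply: ub_le_sup; [exists (u k + d k) => _ [j _ <-]|exists k].
apply: ge_sup; first by exists (u 0%N - d 0%N); exists 0%N.
by move=> _ [j _ <-].
Qed.

Section AlmostAdditive.
Variables (R : realType) (T g C : R) (A : R -> R -> R).
Hypotheses (T_gt0 : 0 < T) (g_gt0 : 0 < g) (g_lt1 : g < 1).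
Hypothesis dA : forall r s u t : R, 0 < r ->
  0 <= s <= T -> 0 <= u <= T -> 0 <= t <= T ->
  `|s - u| <= r -> `|u - t| <= r -> `|s - t| <= r ->
  `|A s t - A s u - A u t| <= C * r `^ g.

Definition mesh k : R := T / 2 ^+ k.
Definition grid k i : R := i%:R * mesh k.

Lemma mesh_gt0 k : 0 < mesh k.
Proof. by rewrite divr_gt0 ?exprn_gt0. Qed.

Lemma meshS k : mesh k = 2 * mesh k.+1.
Proof.
by rewrite /mesh exprS invfM mulrCA [2 * (_ * _)]mulrA divff ?pnatr_eq0 ?mul1r.
Qed.

Lemma grid_double k i : grid k.+1 i.*2 = grid k i.
Proof. by rewrite /grid [mesh k]meshS -mul2n natrM; ring. Qed.

Lemma gridS k i : grid k i.+1 = grid k i + mesh k.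
Proof. by rewrite /grid -natr1; ring. Qed.

Lemma grid_in k i : (i <= 2 ^ k)%N -> 0 <= grid k i <= T.
Proof.
move=> ik; have m := mesh_gt0 k.
rewrite /grid mulr_ge0 ?ler0n ?(ltW m) //= mulrA ler_pdivrMr ?exprn_gt0 //.
by rewrite mulrC ler_wpM2l ?(ltW T_gt0) // -natrX ler_nat.
Qed.

(* [defect k i] is the error [A - df] on the i-th interval of level k; at each
   subdivision it is split evenly between the two halves. *)
Fixpoint defect k i : R :=
  if k is k'.+1 then
    let a := grid k' i./2 in
    let b := grid k' i./2.+1 in
    let m := grid k i./2.*2.+1 in
    (defect k' i./2 - (A a b - A a m - A m b)) / 2
  else 0.

(** Values on the grid of level [k] of the primitive that starts at 0 and has increments
    [A - defect]. *)
Definition gridfun k i : R :=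
  \sum_(0 <= j < i) (A (grid k j) (grid k j.+1) - defect k j).

Lemma gridfunS k i :
  gridfun k i.+1 = gridfun k i + A (grid k i) (grid k i.+1) - defect k i.
Proof. by rewrite /gridfun big_nat_recr //= addrA. Qed.

(** The defects of the two halves of an interval add up to its own defect minus the additivity error
    at the midpoint, so both levels have the same increment over the interval. *)
Lemma gridfun_double k i : gridfun k.+1 i.*2 = gridfun k i.
Proof.
elim: i => [|i IH]; first by rewrite /gridfun !big_geq.
rewrite doubleS !gridfunS IH -doubleS !grid_double /= uphalf_double doubleK.
rewrite ?grid_double; lra.
Qed.

Lemma half_pow_lt1 (a : R) : 0 < a -> 2^-1 `^ a < 1 :> R.
Proof.
move=> a0; have h : (2^-1 : R) < 1 by rewrite invf_lt1 ?ltr1n.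
have := @gt0_ltr_powR R a a0 (2^-1) 1.
by rewrite !nnegrE invr_ge0 powR1; apply.
Qed.

Local Notation q := (2^-1 `^ g).
Local Notation e k := (mesh k `^ g).

Lemma mesh_powS k : e k.+1 = q * e k.
Proof.
rewrite -powRM ?invr_ge0 ?(ltW (mesh_gt0 _)) //; congr (_ `^ _).
by rewrite [mesh k]meshS; field.
Qed.

(** This is where [g < 1] enters: [q] times 2^(-(1 - g)) is one half, and the second factor is below
    1. *)
Lemma half_pow_gt : 1 < 2 * q.
Proof.
have : q * 2^-1 `^ (1 - g) = 2^-1 :> R.
  rewrite -powRD; first by rewrite addrC subrK powRr1 ?invr_ge0.
  by rewrite invr_eq0 pnatr_eq0 implybT.
have : 0 < q by rewrite powR_gt0 // invr_gt0.
have := @half_pow_lt1 (1 - g); rewrite subr_gt0 => /(_ g_lt1).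
set x := _ `^ g; set y := _ `^ _ => y1 x0 xy.
have : 0 < x * (1 - y) by rewrite mulr_gt0 // subr_gt0.
rewrite mulrBr mulr1 xy; lra.
Qed.

Lemma mesh_pow_gt0 k : 0 < e k.
Proof. exact: powR_gt0 (mesh_gt0 k). Qed.

Lemma C_ge0 : 0 <= C.
Proof.
have T0 : 0 <= T <= T by rewrite ltW /=.
have := @dA T T T T T_gt0 T0 T0 T0; rewrite subrr normr0.
move=> /(_ (ltW T_gt0) (ltW T_gt0) (ltW T_gt0)) h.
by have := le_trans (normr_ge0 _) h; rewrite pmulr_lge0 // powR_gt0.
Qed.

(* The fixed point of the recursion [K |-> (K + C) / (2 q)] for the bound on
   [defect k i / mesh k `^ g]. *)
Let K := C / (2 * q - 1).

Lemma K_ge0 : 0 <= K.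
Proof. by rewrite divr_ge0 ?C_ge0 // subr_ge0 ltW ?half_pow_gt. Qed.

(** Since K (2 q - 1) = C, the induction closes: (K e_k + C e_k) / 2 = K q e_k = K e_(k+1). *)
Lemma defect_bound k i : (i < 2 ^ k)%N -> `|defect k i| <= K * e k.
Proof.
elim: k i => [|k IH] i ik; first by rewrite normr0 mulr_ge0 ?K_ge0 ?powR_ge0.
have ik' : (i./2 < 2 ^ k)%N by move: ik; rewrite expnS; lia.
have := IH _ ik'; rewrite /=.
set a := grid k _; set b := grid k _; set m := grid k.+1 _.
have am : m = a + mesh k.+1 by rewrite /m gridS grid_double.
have mb : b = m + mesh k.+1 by rewrite am /b gridS -/a [mesh k]meshS; lra.
have mu := mesh_gt0 k.+1.
have := @dA (mesh k) a m b (mesh_gt0 k).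
move=> /(_ (grid_in (ltnW ik'))).
have min : 0 <= m <= T by apply: grid_in; rewrite expnS; lia.
move=> /(_ min (grid_in ik')).
have -> : `|a - m| <= mesh k.
  by rewrite distrC am addrAC subrr add0r ger0_norm ?ltW // [mesh k]meshS; lra.
have -> : `|m - b| <= mesh k.
  by rewrite distrC mb addrAC subrr add0r ger0_norm ?ltW // [mesh k]meshS; lra.
have -> : `|a - b| <= mesh k.
  by rewrite distrC /b gridS addrAC subrr add0r ger0_norm // ltW // mesh_gt0.
move=> /(_ isT isT isT) h d.
rewrite normrM [`|2^-1|]ger0_norm ?invr_ge0 // mesh_powS.
rewrite ler_pdivrMr //; apply: le_trans (ler_normB _ _) _.
apply: le_trans (lerD d h) _.
have -> : K * (q * e k) * 2 = (K * (2 * q)) * e k by ring.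
rewrite -mulrDl ler_wpM2r ?powR_ge0 //.
have : K * (2 * q - 1) = C by rewrite divfK // gt_eqF // subr_gt0 half_pow_gt.
by rewrite mulrBr mulr1; lra.
Qed.


(** * From grid points to arbitrary times *)

Lemma dA_within (a r x y z : R) : 0 < r ->
  0 <= x <= T -> 0 <= y <= T -> 0 <= z <= T ->
  a <= x <= a + r -> a <= y <= a + r -> a <= z <= a + r ->
  `|A x z - A x y - A y z| <= C * r `^ g.
Proof.
move=> r0 xT yT zT /andP[ax xa] /andP[ay ya] /andP[az za].
by apply: dA => //; rewrite ler_norml; lra.
Qed.

(** Index of the last grid point at or before [t]. At [t = T] it is [2 ^ k], which is not the left
    end of an interval of [0, T]. *)
Definition grid_index k (t : R) : nat := Num.truncn (t / mesh k).

Lemma index_bounds k t : 0 <= t ->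
  grid k (grid_index k t) <= t < grid k (grid_index k t) + mesh k.
Proof.
move=> t0; have m := mesh_gt0 k; rewrite -gridS /grid.
rewrite -ler_pdivlMr // -ltr_pdivrMr //.
by apply: truncn_itv; rewrite divr_ge0 // ltW.
Qed.

Lemma index_uniq k t n : grid k n <= t < grid k n.+1 -> grid_index k t = n.
Proof.
have m := mesh_gt0 k; rewrite /grid -ler_pdivlMr // -ltr_pdivrMr //.
exact: truncn_def.
Qed.

Lemma grid_le k i : (grid k i <= T) = (i <= 2 ^ k)%N.
Proof.
rewrite /grid mulrA ler_pdivrMr ?exprn_gt0 // mulrC ler_pM2l //.
by rewrite -natrX ler_nat.
Qed.

Lemma index_in k t : 0 <= t <= T -> (grid_index k t <= 2 ^ k)%N.
Proof.
case/andP=> t0 tT; rewrite -grid_le.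
by case/andP: (index_bounds k t0) => + _; move/le_trans; apply.
Qed.

Lemma grid_index_in k t : 0 <= t <= T -> 0 <= grid k (grid_index k t) <= T.
Proof. by move/(index_in k)/grid_in. Qed.

Lemma index_half k t : 0 <= t -> (grid_index k.+1 t)./2 = grid_index k t.
Proof.
move=> t0; apply/esym/index_uniq.
have := index_bounds k.+1 t0; set n := grid_index _ _.
have := odd_double_half n; rewrite -!(grid_double k) doubleS.
have := mesh_gt0 k.+1.
case: (odd n) => m /= {1 2}<-; rewrite ?add0n ?add1n ?gridS; lra.
Qed.

(** The primitive at the grid point before [t], continued up to [t] by [A] itself; [f t] is chosen
    below as the limit of these values. *)
Definition approx k t : R :=
  gridfun k (grid_index k t) + A (grid k (grid_index k t)) t.

(** Refining the grid either keeps the grid point before [t], and nothing changes, or moves it to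
    the midpoint; the change is then one defect of level [k.+1] and one additivity error. *)
Lemma approx_step k t : 0 <= t <= T ->
  `|approx k.+1 t - approx k t| <= (K * q + C) * e k.
Proof.
move=> tT; have /andP[t0 tT'] := tT; have m := mesh_gt0 k.+1.
have q0 : 0 < q by rewrite powR_gt0 // invr_gt0.
have e0 := mesh_pow_gt0 k; have K0 := K_ge0; have C0 := C_ge0.
have B0 : 0 <= (K * q + C) * e k.
  by rewrite mulr_ge0 ?(ltW e0) // addr_ge0 // mulr_ge0 // ltW.
have := index_bounds k.+1 t0; have := index_in k.+1 tT.
have := odd_double_half (grid_index k.+1 t); rewrite index_half //.
have := index_in k tT; have := index_bounds k t0.
rewrite /approx; set n := grid_index k t; set n' := grid_index _ _.
case: (odd n') => /= nt nk <-; rewrite ?add0n ?add1n; last first.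
  by rewrite gridfun_double grid_double subrr normr0.
move=> n'k n't; rewrite gridfunS gridfun_double grid_double.
rewrite gridS grid_double in n't *.
set p := grid k n in nt n't *; set b := defect _ _.
have pT : 0 <= p <= T by apply: grid_in.
have bb : `|b| <= K * (q * e k).
  by rewrite -mesh_powS; exact: defect_bound.
have d : `|A p t - A p (p + mesh k.+1) - A (p + mesh k.+1) t| <= C * e k.
  have mk := meshS k.
  by apply: (@dA_within p); rewrite ?mesh_gt0 //; lra.
have -> : gridfun k n + A p (p + mesh k.+1) - b + A (p + mesh k.+1) t
    - (gridfun k n + A p t)
  = - b - (A p t - A p (p + mesh k.+1) - A (p + mesh k.+1) t) by ring.
apply: le_trans (ler_normB _ _) _; rewrite normrN.
by apply: le_trans (lerD bb d) _; rewrite mulrDl mulrA.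
Qed.

(** The two times lie in the same grid interval or in adjacent ones. The first case costs one
    additivity error, the second costs two and the defect of the earlier interval. *)
Lemma approx_local k s t : 0 <= s -> s <= t -> t <= T -> t - s <= mesh k ->
  `|A s t - (approx k t - approx k s)| <= 2 * (C * (2 * mesh k) `^ g) + K * e k.
Proof.
move=> s0 st tT stk; have m := mesh_gt0 k.
have sT : 0 <= s <= T by rewrite s0 (le_trans st).
have t0 : 0 <= t <= T by rewrite tT (le_trans s0).
have pT := grid_index_in k sT; have p'T := grid_index_in k t0.
have C0 := C_ge0; have K0 := mulr_ge0 K_ge0 (ltW (mesh_pow_gt0 k)).
have D0 : 0 <= C * (2 * mesh k) `^ g by rewrite mulr_ge0 // powR_ge0.
have := index_in k t0; have := index_in k sT.
have := index_bounds k s0; have /andP[/(index_bounds k) + _] := t0.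
move: pT p'T; rewrite /approx; set n := grid_index k s; set n' := grid_index k t.
move=> pT p'T n't ns nk n'k.
have r0 : 0 < 2 * mesh k by lra.
have [nn'|n'n] := leqP n' n.
  have n'E : n' = n.
    apply/eqP; rewrite eqn_leq nn' leqNgt; apply/negP => n'n.
    have : grid k n'.+1 <= grid k n by rewrite /grid ler_wpM2r ?ler_nat // ltW.
    by rewrite gridS; lra.
  rewrite n'E in n't p'T *; set p := grid k n in ns n't pT p'T *.
  have d : `|A p t - A p s - A s t| <= C * (2 * mesh k) `^ g.
    by apply: (@dA_within p) => //; lra.
  have -> : A s t - (gridfun k n + A p t - (gridfun k n + A p s))
    = - (A p t - A p s - A s t) by ring.
  by rewrite normrN; lra.
have n'E : n' = n.+1.
  apply/eqP; rewrite eqn_leq n'n andbT leqNgt; apply/negP => nn'.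
  have : grid k n.+2 <= grid k n' by rewrite /grid ler_wpM2r ?ler_nat // ltW.
  by rewrite !gridS; lra.
have nk' : (n < 2 ^ k)%N by rewrite -n'E.
have b := defect_bound nk'.
rewrite n'E gridfunS in n't p'T *; rewrite gridS in n't p'T *.
set p := grid k n in ns n't pT p'T *.
have d : `|A p t - A p s - A s t| <= C * (2 * mesh k) `^ g.
  by apply: (@dA_within p) => //; lra.
have d' : `|A p t - A p (p + mesh k) - A (p + mesh k) t|
    <= C * (2 * mesh k) `^ g.
  by apply: (@dA_within p) => //; lra.
rewrite (_ : _ - _ = - (A p t - A p s - A s t)
  + (A p t - A p (p + mesh k) - A (p + mesh k) t) + defect k n); last by ring.
apply: le_trans (ler_normD _ _) _; apply: lerD b.
apply: le_trans (ler_normD _ _) _; rewrite normrN; lra.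
Qed.

Lemma mesh_scale r : 0 < r <= T -> exists k, mesh k.+1 < r <= mesh k.
Proof.
case/andP=> r0 rT.
have ex : exists k, mesh k < r.
  exists (Num.bound (T / r)).
  by rewrite /mesh ltr_pdivrMr ?exprn_gt0 // mulrC -ltr_pdivrMr // upper_nthrootP.
(* The least level with mesh below [r] is not 0, because [mesh 0 = T >= r]; its predecessor is the
   level sought. *)
case: (ex_minnP ex) => -[|k] kr kmin.
  by move: kr; rewrite /mesh expr0 divr1 ltNge rT.
exists k; by rewrite kr leNgt; apply/negP => /kmin; rewrite ltnn.
Qed.

Lemma almost_additive_primitive : exists (f : R -> R) (C' : R),
  forall r s t : R, 0 < r -> 0 <= s <= T -> 0 <= t <= T -> `|s - t| <= r ->
  `|A s t - (f t - f s)| <= C' * r `^ g.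
Proof.
have q1 := half_pow_lt1 g_gt0; have C0 := C_ge0; have K0 := K_ge0.
have q0 : 0 < q by rewrite powR_gt0 // invr_gt0.
(* [L * e k] is the tail from [k] on of the geometric series of the bounds in [approx_step]. *)
pose L := (K * q + C) / (1 - q).
have L0 : 0 <= L by rewrite divr_ge0 ?subr_ge0 ?(ltW q1) // addr_ge0 // mulr_ge0 // ltW.
have /choice[f fP] t : exists x, 0 <= t <= T ->
    forall k, `|x - approx k t| <= L * e k.
  have [tT|_] := boolP (0 <= t <= T); last by exists 0.
  have [|k|x xP] := @nested_limit R (approx^~ t) (fun k => L * e k).
  - by move=> k; rewrite mulr_ge0 // powR_ge0.
  - have -> : L * e k - L * e k.+1 = (K * q + C) * e k.
      rewrite mesh_powS; have : L * (1 - q) = K * q + C.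
        by rewrite divfK // subr_eq0 gt_eqF.
      by move<-; ring.
    exact: approx_step.
  - by exists x.
pose P : R := 2 `^ g.
have P0 : 0 < P by rewrite powR_gt0.
(* The bracket collects the bound of [approx_local] and one [L] for each endpoint; the last [P]
   passes from the power of [mesh k] to that of [r], as [mesh k < 2 * r]. *)
pose M := (2 * (C * P) + K + 2 * L) * P.
have M0 : 0 <= M by repeat first [done | exact: ltW | apply: addr_ge0 | apply: mulr_ge0].
have key r s t : 0 < r <= T -> 0 <= s -> s <= t -> t <= T -> t - s <= r ->
    `|A s t - (f t - f s)| <= M * r `^ g.
  move=> rT s0 st tT sr; have [k /andP[kr rk]] := mesh_scale rT.
  have sT : 0 <= s <= T by rewrite s0 (le_trans st).
  have t0 : 0 <= t <= T by rewrite tT (le_trans s0).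
  have := approx_local s0 st tT (le_trans sr rk).
  have := fP _ sT k; have := fP _ t0 k.
  rewrite powRM ?(ltW (mesh_gt0 k)) // -/P => ht hs h.
  have er : e k <= P * r `^ g.
    have [r0 _] := andP rT; have m := mesh_gt0 k; have mk := meshS k.
    rewrite -powRM ?(ltW r0) // ge0_ler_powR ?nnegrE ?(ltW g_gt0) ?(ltW m) //; lra.
  have : (2 * (C * P) + K + 2 * L) * e k <= M * r `^ g.
    rewrite -mulrA ler_wpM2l //.
    by repeat first [done | exact: ltW | apply: addr_ge0 | apply: mulr_ge0].
  apply: le_trans.
  have -> : (2 * (C * P) + K + 2 * L) * e k =
    2 * (C * (P * e k)) + K * e k + L * e k + L * e k by ring.
  rewrite (_ : A s t - (f t - f s) = (A s t - (approx k t - approx k s))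
    - (f t - approx k t) + (f s - approx k s)); last by ring.
  apply: le_trans (ler_normD _ _) _; apply: lerD hs.
  by apply: le_trans (ler_normB _ _) _; apply: lerD ht.
(* The term [2 * C] pays for [s > t]: reversing the order costs the additivity errors of the triples
   (s, t, s) and (s, s, s). *)
exists f, (M + 2 * C) => r s t r0 sT tT str.
have {}key s' t' : 0 <= s' -> s' <= t' -> t' <= T -> t' - s' <= r ->
    `|A s' t' - (f t' - f s')| <= M * r `^ g.
  (* [mesh_scale] covers scales up to [T] only; distances never exceed [T], so a larger scale can be
     truncated. *)
  move=> s0 st t'T sr; pose r' := Num.min r T.
  have r'0 : 0 < r' <= T by rewrite lt_min r0 T_gt0 ge_min lexx orbT.
  have : t' - s' <= r' by rewrite le_min sr; lra.
  move/(key r' s' t' r'0 s0 st t'T)/le_trans; apply.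
  rewrite ler_wpM2l // ge0_ler_powR ?nnegrE ?(ltW g_gt0) ?(ltW r0) //.
    by case/andP: r'0 => /ltW.
  by rewrite ge_min lexx.
have Cr0 : 0 <= C * r `^ g by rewrite mulr_ge0 // powR_ge0.
have [[s0 sT'] [t0 tT']] := (andP sT, andP tT).
have [st|/ltW ts] := leP s t.
  have := key s t s0 st tT'; rewrite distrC ger0_norm ?subr_ge0 // in str.
  by move=> /(_ str); rewrite mulrDl; lra.
rewrite ger0_norm ?subr_ge0 // in str.
have := key t s t0 ts sT' str.
have ss : `|s - s| <= r by rewrite subrr normr0 ltW.
have sd : `|s - t| <= r by rewrite ger0_norm // subr_ge0.
have ds := dA r0 sT sT sT ss ss ss.
have dst := dA r0 sT tT sT sd; rewrite distrC in sd; move: (dst sd ss) => {}dst h.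
rewrite (_ : A s t - (f t - f s) = - (A t s - (f s - f t)) - (A s s - A s t - A t s)
  - (A s s - A s s - A s s)); last by ring.
apply: le_trans (ler_normB _ _) _.
have -> : (M + 2 * C) * r `^ g = M * r `^ g + C * r `^ g + C * r `^ g.
  by ring.
by apply: lerD ds; apply: le_trans (ler_normB _ _) _; rewrite normrN lerD.
Qed.

End AlmostAdditive.

(** * Uniform bounds up to a constant *)

Section Dominated.
Variables (R : realType) (I : Type) (P : I -> Prop).
Implicit Types F G w : I -> R.

(** F = O(w) on [P]. An index will carry the times and the scale together, so that the constant is
    uniform in them. *)
Definition dominated w F := exists C : R, forall i, P i -> `|F i| <= C * w i.

Lemma dominated_sum (J : eqType) (s : seq J) (Q : pred J) (F : J -> I -> R) w :
  (forall c, c \in s -> Q c -> dominated w (F c)) ->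
  dominated w (fun i => \sum_(c <- s | Q c) F c i).
Proof.
elim: s => [_|c s IH H]; first by exists 0 => i _; rewrite big_nil normr0 mul0r.
have [C CP] := IH (fun d ds => H d (mem_behead (s := c :: s) ds)).
have [Qc|nQc] := boolP (Q c); last first.
  by exists C => i Pi; rewrite big_cons (negbTE nQc); apply: CP.
have [D DP] := H c (mem_head c s) Qc; exists (D + C) => i Pi.
rewrite big_cons Qc mulrDl.
by apply: le_trans (ler_normD _ _) _; rewrite lerD ?DP ?CP.
Qed.

Lemma dominated_mul w w' F G : dominated w F -> dominated w' G ->
  dominated (fun i => w i * w' i) (fun i => F i * G i).
Proof.
move=> [C CP] [D DP]; exists (C * D) => i Pi.
by rewrite normrM mulrACA ler_pM ?CP ?DP.
Qed.

Lemma dominated_prod (J : eqType) (s : seq J) (F w : J -> I -> R) :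
  (forall c, c \in s -> dominated (w c) (F c)) ->
  dominated (fun i => \prod_(c <- s) w c i) (fun i => \prod_(c <- s) F c i).
Proof.
elim: s => [_|c s IH H].
  by exists 1 => i _; rewrite !big_nil normr1 mulr1.
have [C CP] := dominated_mul (H c (mem_head c s))
  (IH (fun d ds => H d (mem_behead (s := c :: s) ds))).
by exists C => i Pi; rewrite !big_cons; apply: CP.
Qed.

End Dominated.

#[local] Arguments aev : simpl never.

(** * The group product on trees, and characters vanishing on trees with few nodes *)

Section Cuts.
Variables (R : realType) (l : nat) (alpha : R).
Local Notation char := (@character R l alpha).
Local Notation small t := (Defs.small alpha (@tree_of l t)).
Implicit Types (a b c : char) (t : ptree l).

(** The cuts that remove nothing contribute [phi t]. This is read off from [tsum0]: for C = 0 all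
    other cuts die, while the terms of these do not depend on C. *)
Lemma tsum_proper (phi C : ptree l -> R) t :
  tsum phi C t = phi t +
    \sum_(d <- root_subtrees t | ~~ nilp d.2) phi d.1 * Defs.fprod C d.2.
Proof.
rewrite /tsum (bigID (fun d => nilp d.2)) /=; congr (_ + _).
rewrite -[RHS](tsum0 phi) /tsum [RHS](bigID (fun d => nilp d.2)) /=.
rewrite [X in _ = _ + X]big1 ?addr0; last first.
  by move=> [p [|u us]] //= _; rewrite /Defs.fprod big_cons mul0r mulr0.
by apply: eq_bigr => d /nilP ->; rewrite /Defs.fprod !big_nil.
Qed.

(** The sum is over the reduced coproduct: the root subtree and the pruned trees all have fewer
    nodes than [t]. *)
Lemma aev_mulg a b t : small t ->
  aev (a * b)%g t = aev a t + aev b t +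
    \sum_(d <- root_subtrees t | ~~ nilp d.2) aev a d.1 * Defs.fprod (aev b) d.2.
Proof.
by move=> st; rewrite [LHS]aev_mul // /tconv tsum_proper addrCA addrA.
Qed.

Lemma aev_one t : small t -> aev (1%g : char) t = 0.
Proof. by move=> st; exact: aev_char_of st. Qed.

Lemma psize_root_subtrees_lt t d : d \in root_subtrees t -> ~~ nilp d.2 ->
  (psize d.1 < psize t)%N.
Proof.
move=> /psize_root_subtrees <-; case: d.2 => // u us _ /=.
by have := psize_gt0 u; lia.
Qed.

Definition vanish n c := forall t, small t -> (psize t <= n)%N -> aev c t = 0.

(** Every root subtree in the reduced coproduct has at most [n] nodes, so [c] kills it. In the
    mirror statement [c] kills a tree of the nonempty pruned forest. *)
Lemma aev_mul_vanishl n c a t : vanish n c -> small t -> (psize t <= n.+1)%N ->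
  aev (c * a)%g t = aev c t + aev a t.
Proof.
move=> cn st tn; rewrite aev_mulg // big_seq_cond big1 ?addr0 // => d.
case/andP=> dt d2; rewrite cn ?mul0r //; first by case: (small_sub st dt).
by rewrite -ltnS; apply: leq_trans tn; apply: psize_root_subtrees_lt.
Qed.

Lemma aev_mul_vanishr n c a t : vanish n c -> small t -> (psize t <= n.+1)%N ->
  aev (a * c)%g t = aev a t + aev c t.
Proof.
move=> cn st tn; rewrite aev_mulg // big_seq_cond big1 ?addr0 // => d.
case/andP=> dt; case: (small_sub st dt) => _; case: d.2 => // u us /(_ u).
rewrite mem_head => /(_ isT)[su ut] _.
by rewrite /Defs.fprod big_cons cn ?mul0r ?mulr0 // -ltnS (leq_trans ut).
Qed.

Lemma aev_inv_vanish n c t : vanish n c -> small t -> (psize t <= n.+1)%N ->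
  aev c^-1%g t = - aev c t.
Proof.
move=> cn st tn; apply/eqP; rewrite -addr_eq0 addrC.
by rewrite -(aev_mul_vanishl _ cn) // mulgV aev_one.
Qed.

Lemma vanishV n c : vanish n c -> vanish n c^-1%g.
Proof.
by move=> cn t st tn; rewrite (aev_inv_vanish cn) ?cn ?oppr0 // ltnW.
Qed.

Lemma vanish0 c : vanish 0 c.
Proof. by move=> t _; rewrite leqNgt psize_gt0. Qed.

End Cuts.

(** * Hölder bounds extended one node at a time *)

Section Extension.
Variables (R : realType) (l : nat) (alpha T : R).
Hypotheses (alpha_gt0 : 0 < alpha) (T_gt0 : 0 < T).
Local Notation char := (@character R l alpha).
Local Notation small t := (Defs.small alpha (@tree_of l t)).

Definition near_pair (i : R * R * R) := let: (r, s, t) := i in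
  [/\ 0 < r, 0 <= s <= T, 0 <= t <= T & `|s - t| <= r].

Definition rough_upto n (g : R -> char) := forall p : ptree l, small p ->
  (psize p <= n)%N ->
  dominated near_pair (fun i => i.1.1 `^ (alpha * (psize p)%:R))
    (fun i => aev (g i.2 * (g i.1.2)^-1)%g p).

Definition near_triple (i : R * R * R * R) := let: (r, s, u, t) := i in
  near_pair (r, s, u) /\ near_pair (r, u, t).

Lemma prod_powR (r : R) (us : seq (ptree l)) : 0 < r ->
  \prod_(u <- us) r `^ (alpha * (psize u)%:R)
  = r `^ (alpha * (sumn (map (@psize l) us))%:R).
Proof.
move=> r0; elim: us => [|u us IH]; first by rewrite big_nil mulr0 powRr0.
by rewrite big_cons IH /= natrD mulrDr powRD // (gt_eqF r0) implybT.
Qed.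

(** By Chen's relation the error is the reduced coproduct sum of two increments. The exponents of
    the factors of a term add up to that of [p], because cutting preserves the total number of
    nodes. *)
Lemma rough_almost_additive n g p : rough_upto n g -> small p ->
  (psize p <= n.+1)%N ->
  dominated near_triple (fun i => i.1.1.1 `^ (alpha * (psize p)%:R))
    (fun i => let: (r, s, u, t) := i in
      aev (g t * (g s)^-1)%g p - aev (g u * (g s)^-1)%g p
      - aev (g t * (g u)^-1)%g p).
Proof.
move=> gn sp pn.
pose F (d : ptree l * seq (ptree l)) (i : R * R * R * R) :=
  aev (g i.2 * (g i.1.2)^-1)%g d.1 *
  \prod_(u <- d.2) aev (g i.1.2 * (g i.1.1.2)^-1)%g u.
have [C CP] : dominated near_triple
    (fun i => i.1.1.1 `^ (alpha * (psize p)%:R))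
    (fun i => \sum_(d <- root_subtrees p | ~~ nilp d.2) F d i).
  apply: dominated_sum => d dp d2; have [s1 s2] := small_sub sp dp.
  have [C1 C1P] : dominated near_triple
      (fun i => i.1.1.1 `^ (alpha * (psize d.1)%:R))
      (fun i => aev (g i.2 * (g i.1.2)^-1)%g d.1).
    have [|C CP] := gn d.1 s1.
      by rewrite -ltnS; apply: leq_trans pn; apply: psize_root_subtrees_lt.
    by exists C => -[[[r s] u] t] [_ /CP].
  have [C2 C2P] : dominated near_triple
      (fun i => \prod_(u <- d.2) i.1.1.1 `^ (alpha * (psize u)%:R))
      (fun i => \prod_(u <- d.2) aev (g i.1.2 * (g i.1.1.2)^-1)%g u).
    apply: dominated_prod => u /s2[su up].
    have [|C CP] := gn u su; first by rewrite -ltnS (leq_trans up).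
    by exists C => -[[[r s] v] t] [/CP].
  have [C CP] := dominated_mul (ex_intro _ C1 C1P) (ex_intro _ C2 C2P).
  exists C => i Pi; apply: le_trans (CP i Pi) _.
  have r0 : 0 < i.1.1.1 by case: i Pi => -[[r s] u] t [[]].
  rewrite prod_powR // -powRD ?(gt_eqF r0) ?implybT // -mulrDr -natrD.
  by rewrite (psize_root_subtrees dp).
exists C => -[[[r s] u] t] Pi; apply: le_trans (CP _ Pi).
rewrite (_ : (g t * (g s)^-1 = (g t * (g u)^-1) * (g u * (g s)^-1))%g); last first.
  by rewrite mulgA mulgVK.
rewrite aev_mulg // /F /Defs.fprod /=; set x := aev _ _; set y := aev _ _.
by set z := \sum_(_ <- _ | _) _; rewrite (_ : x + y + z - y - x = z) //; ring.
Qed.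

Lemma rough_extend n g : rough_upto n g -> exists g' : R -> char,
  rough_upto n.+1 g' /\
  forall t p, small p -> (psize p <= n)%N -> aev (g' t) p = aev (g t) p.
Proof.
move=> gn.
have /choice[f fP] (x : small_tree l alpha) : exists f : R -> R,
    tree_size (val x) = n.+1 -> exists C', forall r s t : R, 0 < r ->
      0 <= s <= T -> 0 <= t <= T -> `|s - t| <= r ->
    `|aev (g t * (g s)^-1)%g (val (val x)) - (f t - f s)|
      <= C' * r `^ (alpha * n.+1%:R).
  have [xn|xn] := eqVneq (tree_size (val x)) n.+1; last first.
    by exists (fun=> 0) => e; rewrite e eqxx in xn.
  have sx := small_tree_small x.
  have [|C CP] := rough_almost_additive gn sx; first by rewrite -xn.
  have [|||f [C' H]] := @almost_additive_primitive R T (alpha * n.+1%:R) C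
    (fun s t => aev (g t * (g s)^-1)%g (val (val x))) T_gt0.
  - by rewrite mulr_gt0 // ltr0n.
  (* The exponent is below 1 precisely because [x] is a small tree. *)
  - by rewrite -xn; apply: valP x.
  - move=> r s u t r0 sT uT tT su ut st.
    by rewrite -xn; apply: (CP (r, s, u, t)).
  by exists f => _; exists C'.
pose c t : char := char_of (fun x => if tree_size (val x) == n.+1 then - f x t else 0).
have cE t p (sp : small p) : aev (c t) p =
    if psize p == n.+1 then - f (exist _ (tree_of p) sp) t else 0.
  by rewrite (aev_char_of _ sp) /= tree_size_of.
have cn t : vanish n (c t).
  by move=> p sp pn; rewrite cE ltn_eqF.
exists (fun t => c t * g t)%g; split=> [p sp pn|t p sp pn]; last first.
  by rewrite (aev_mul_vanishl _ (cn t)) ?cn ?add0r // ltnW.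
(* The new increment is c_t (g_t g_s^-1) c_s^-1, and both outer factors vanish up to [n] nodes. *)
have incr s t : aev ((c t * g t) * (c s * g s)^-1)%g p
    = aev (g t * (g s)^-1)%g p + aev (c t) p - aev (c s) p.
  rewrite invgM mulgA -(mulgA (c t)).
  rewrite (aev_mul_vanishr _ (vanishV (cn s))) // (aev_mul_vanishl _ (cn t)) //.
  by rewrite (aev_inv_vanish (cn s)) // [aev (c t) p + _]addrC.
have [pn1|pn1] := eqVneq (psize p) n.+1; last first.
  have [|C CP] := gn p sp; first by rewrite -ltnS ltn_neqAle pn1.
  exists C => -[[r s] t] /CP /=.
  by rewrite incr !cE (negbTE pn1) subr0 addr0.
have [|C CP] := fP (exist _ (tree_of p) sp); first by rewrite tree_size_of.
exists C => -[[r s] t] [r0 sT tT st] /=.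
rewrite incr !cE pn1 eqxx; have /= := CP r s t r0 sT tT st.
by rewrite aev_inv opprK opprB [f _ s - _]addrC addrA.
Qed.

Lemma rough_extend_all n m g : rough_upto n g -> exists g' : R -> char,
  rough_upto (n + m) g' /\
  forall t p, small p -> (psize p <= n)%N -> aev (g' t) p = aev (g t) p.
Proof.
move=> gn; elim: m => [|m [g1 [g1n g1g]]]; first by rewrite addn0; exists g.
have [g2 [g2n g2g]] := rough_extend g1n; exists g2; rewrite addnS; split=> // t p sp pn.
by rewrite g2g ?g1g // (leq_trans pn) ?leq_addr.
Qed.

(** Write g_t = (g_t g_0^-1) g_0: the first factor is controlled by the Hölder bound at scale [T],
    the second does not depend on t. *)
Lemma rough_bounded n g p : rough_upto n g -> small p -> (psize p <= n)%N ->
  dominated (fun t => 0 <= t <= T) (fun=> 1) (fun t => aev (g t) p).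
Proof.
move=> gn sp pn.
have gb q : small q -> (psize q <= n)%N ->
    dominated (fun t => 0 <= t <= T) (fun=> 1)
      (fun t => aev (g t * (g 0)^-1)%g q).
  move=> sq qn; have [C CP] := gn q sq qn.
  exists (C * T `^ (alpha * (psize q)%:R)) => t tT; rewrite mulr1.
  apply: (CP (T, 0, t)); split=> //; first by rewrite lexx ltW.
  by case/andP: tT => t0 tT; rewrite distrC subr0 ger0_norm.
have cst (x : R) : dominated (fun t : R => 0 <= t <= T) (fun=> 1) (fun=> x).
  by exists `|x| => t _; rewrite mulr1.
have [C CP] := gb p sp pn; have [D DP] := cst (aev (g 0) p).
have [E EP] : dominated (fun t => 0 <= t <= T) (fun=> 1)
    (fun t => \sum_(d <- root_subtrees p | ~~ nilp d.2)
      aev (g t * (g 0)^-1)%g d.1 * Defs.fprod (aev (g 0)) d.2).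
  apply: dominated_sum => d dp d2; have [s1 s2] := small_sub sp dp.
  have [|C1 C1P] := gb d.1 s1.
    by apply: leq_trans pn; apply/ltnW/psize_root_subtrees_lt.
  have [C2 C2P] := dominated_mul (ex_intro _ C1 C1P) (cst (Defs.fprod (aev (g 0)) d.2)).
  by exists C2 => t tT; apply: le_trans (C2P t tT) _; rewrite mulr1.
exists (C + D + E) => t tT; rewrite mulr1.
rewrite -[g t](mulgVK (g 0)) aev_mulg //.
have := CP t tT; have := DP t tT; have := EP t tT; rewrite !mulr1 => e d c.
apply: le_trans (ler_normD _ _) _; apply: lerD e.
by apply: le_trans (ler_normD _ _) _; apply: lerD.
Qed.

Definition root_decoration (p : ptree l) : 'I_l := let: PNode j _ := p in j.

Lemma row_entry_le_norm (x : 'rV[R]_l) j : `|x ord0 j| <= `|x|.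
Proof.
rewrite [leRHS]/Num.Def.normr /= mx_normrE.
exact: (@le_bigmax _ _ _ _ (fun ij : 'I_1 * 'I_l => `|x ij.1 ij.2|) (ord0, j)).
Qed.

(** The starting path sends a tree to the component of [h] at its root decoration. Control is
    claimed on one-node trees only, where products of characters are additive. *)
Lemma rough_init (h : R -> 'rV[R]_l) : holder_control alpha T h ->
  rough_upto 1 (fun t => char_of (fun x => h t ord0 (root_decoration (val (val x))))).
Proof.
move=> [C CP] p sp p1.
have rootE : root_decoration (Defs.canon p) = root_decoration p by case: p {sp p1}.
have -> : psize p = 1%N by apply/eqP; rewrite eqn_leq p1 psize_gt0.
(* The absolute value makes the bound nonnegative, which the case [s = t] uses. *)
exists `|C| => -[[r s] t] [r0 sT tT st] /=; rewrite mulr1.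
rewrite (aev_mul_vanishl _ (vanish0 _)) // (aev_inv_vanish (vanish0 _)) //.
rewrite !(aev_char_of _ sp) /= rootE.
have [<-|nst] := eqVneq s t; first by rewrite subrr normr0 mulr_ge0 ?powR_ge0.
have st0 : 0 < `|t - s| by rewrite normr_gt0 subr_eq0 eq_sym.
have := CP s t; rewrite !in_itv /= => /(_ sT tT nst).
rewrite ler_pdivrMr ?powR_gt0 // => hC.
have -> : h t ord0 (root_decoration p) - h s ord0 (root_decoration p)
  = (h t - h s) ord0 (root_decoration p) by rewrite !mxE.
apply: le_trans (row_entry_le_norm _ _) _; apply: le_trans hC _.
apply: (@le_trans _ _ (`|C| * `|t - s| `^ alpha)).
  by rewrite ler_wpM2r ?powR_ge0 ?ler_norm.
rewrite ler_wpM2l //; apply: ge0_ler_powR; rewrite ?nnegrE ?(ltW alpha_gt0) ?(ltW r0) //.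
by rewrite distrC.
Qed.

End Extension.

(** * All small trees reached in finitely many steps *)

Theorem corollary3 (R : realType) (alpha T : R) (l : nat)
    (alpha_gt0 : 0 < alpha) (alpha_lt1 : alpha < 1) (T_gt0 : 0 < T)
    (l_ge1 : (1 <= l)%N) (h : R -> 'rV[R]_l) (hh : holder_control alpha T h) :
  exists g : R -> character l alpha,
    branched_rough_path T g /\
    forall (t : R) (j : 'I_l), 0 <= t <= T ->
      g t (tree_elt (bullet_elt alpha_lt1 j)) = h t ord0 j.
Proof.
(* A small tree has fewer than 1/alpha nodes, so [N] extensions from level 1 reach all of them. *)
pose N := Num.bound alpha^-1.
have smallN (x : small_tree l alpha) : (psize (val (val x)) <= 1 + N)%N.
  apply/leqW/ltnW; rewrite -(ltr_nat R).
  apply: lt_trans (archi_boundP _); last by rewrite invr_ge0 ltW.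
  by rewrite -[ltRHS]mul1r ltr_pdivlMr // mulrC; apply: (valP x).
have [g [gN gh]] := rough_extend_all alpha_gt0 T_gt0 N (rough_init alpha_gt0 hh).
exists g; split=> [x|t j tT].
  have sx := small_tree_small x; split.
    have [C CP] := rough_bounded T_gt0 gN sx (smallN x).
    exists C => t; rewrite in_itv /= => tT.
    by have := CP t tT; rewrite mulr1 aev_small.
  have [C CP] := gN _ sx (smallN x).
  exists C => s t; rewrite !in_itv /= => sT tT st.
  have ts : 0 < `|t - s| by rewrite normr_gt0 subr_eq0 eq_sym.
  rewrite ler_pdivrMr ?powR_gt0 //.
  (* The scale is now the distance itself, positive since [s != t]. *)
  have /= := CP (`|t - s|, s, t); rewrite aev_small; apply; split=> //.
  by rewrite distrC.
have sb : Defs.small alpha (tree_of (PNode j [::])) by apply: small_bullet.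
(* A bullet has one node, and the extensions keep the values on such trees. *)
rewrite -aev_small /= (gh t (PNode j [::]) sb) //.
by rewrite (aev_char_of _ sb).
Qed.
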